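(* Let $b\in\mathbb{C}$ with $b^2\notin\{0,2,4,6,\dots\}$. The functions $\hat h_n(x)=\hat h_n(x;b)$, $n\in\mathbb{N}_0$, satisfy the recurrence relation $$\begin{aligned}(x+b)^2\hat h_n&=(\mathsf J+b)^2\hat h_n+\left(\mathsf V\hat{\mathsf V}-\mathsf U\hat{\mathsf U}\right)\hat h_n\\&=\hat h_{n+2}+2b\,\hat h_{n+1}+\left(b^2+n+\tfrac12\right)\hat h_n+bn\,\hat h_{n-1}+\tfrac14n(n-1)\hat h_{n-2}\\&\qquad+2\hat v_{n+1}+b\,\hat v_n-b\,\hat u_n-n\,\hat u_{n-1},\end{aligned}$$ where $$\hat v_n=\hat{\mathsf V}\hat h_n=\frac{2\hat h_{n+1}+b\,\hat h_n}{b^2-2n-2},\qquad \hat u_n=\hat{\mathsf U}\hat h_n=\frac{b\,\hat h_n+n\,\hat h_{n-1}}{b^2-2n}.$$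
   Context: $h_n(x)=\sum_{j=0}^{\lfloor n/2\rfloor}\frac{n!}{(n-2j)!\,j!}x^{n-2j}(-4)^{-j}$, $n\in\mathbb{N}_0$, are the monic Hermite polynomials, and $$\hat h_n(x;b)=(b^2-2n)h_n(x)-\frac{b\,h_n(x)+n\,h_{n-1}(x)}{x+b}.$$ $\mathsf S_n$ is the shift operator on sequences: $\mathsf S_n^kf_n=f_{n+k}$. The difference operators, acting on sequences indexed by $n$ (products denote composition, the rightmost operator acting first on the sequence), are $$\mathsf J=\mathsf S_n+\tfrac n2\mathsf S_n^{-1},\quad \mathsf U=b+n\mathsf S_n^{-1},\quad \hat{\mathsf U}=(b^2-2n)^{-1}\mathsf U,\quad \mathsf V=2\mathsf S_n+b,\quad \hat{\mathsf V}=(b^2-2n-2)^{-1}\mathsf V.$$ Terms with a negative index always carry a vanishing coefficient and are taken to be $0$. *)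

(* Defs.v *)
(* Mathematical Components; the complex numbers are [R[i]] for [R : realType]. *)
From HB Require Import structures.
From mathcomp Require Import all_boot all_order all_algebra.
From mathcomp Require Import reals.
From mathcomp.real_closed Require Import complex.

Set Implicit Arguments.
Unset Strict Implicit.
Unset Printing Implicit Defensive.

Import Order.TTheory GRing.Theory Num.Theory.
Local Open Scope ring_scope.

(* Extension by 0 to negative indices: f_k = 0 for k < 0. *)
Definition extz (F : fieldType) (f : nat -> F) (k : int) : F :=
  match k with Posz m => f m | Negz _ => 0 end.

Definition seqop (F : fieldType) : Type := (nat -> F) -> (nat -> F).

Definition shift (F : fieldType) (k : int) : seqop F :=
  fun f n => extz f (n%:Z + k).

(* Multiplication by the coefficient sequence c. *)
Definition coefop (F : fieldType) (c : nat -> F) : seqop F :=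
  fun f n => c n * f n.

Definition addop (F : fieldType) (A B : seqop F) : seqop F :=
  fun f n => A f n + B f n.

Definition subop (F : fieldType) (A B : seqop F) : seqop F :=
  fun f n => A f n - B f n.

(* Rightmost operator acts first. *)
Definition mulop (F : fieldType) (A B : seqop F) : seqop F :=
  fun f => A (B f).

Declare Scope seqop_scope.
Delimit Scope seqop_scope with op.
Bind Scope seqop_scope with seqop.
Notation "A + B" := (addop A B) : seqop_scope.
Notation "A - B" := (subop A B) : seqop_scope.
Notation "A * B" := (mulop A B) : seqop_scope.

Definition scalop (F : fieldType) (b : F) : seqop F := coefop (fun=> b).

Definition Jop (F : fieldType) : seqop F :=
  (shift 1%R + coefop (fun n => n%:R / 2%:R) * shift (- 1)%R)%op.

Definition Uop (F : fieldType) (b : F) : seqop F :=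
  (scalop b + coefop (fun n => n%:R) * shift (- 1)%R)%op.

Definition Uhatop (F : fieldType) (b : F) : seqop F :=
  (coefop (fun n => (b ^+ 2 - 2%:R * n%:R)^-1) * Uop b)%op.

Definition Vop (F : fieldType) (b : F) : seqop F :=
  (scalop 2%:R * shift 1%R + scalop b)%op.

Definition Vhatop (F : fieldType) (b : F) : seqop F :=
  (coefop (fun n => (b ^+ 2 - 2%:R * n%:R - 2%:R)^-1) * Vop b)%op.

Definition hermite (F : fieldType) (n : nat) : {poly F} :=
  \sum_(j < n./2.+1)
    ((n`!)%:R / (((n - 2 * j)`!)%:R * (j`!)%:R) * (- 4%:R) ^- j)
      *: 'X^(n - 2 * j).

(* As a function of x this is only meaningful for x + b != 0. *)
Definition hhat (F : fieldType) (b : F) (n : nat) (x : F) : F :=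
  (b ^+ 2 - 2%:R * n%:R) * (hermite F n).[x]
  - (b * (hermite F n).[x]
     + n%:R * extz (fun m => (hermite F m).[x]) (n%:Z - 1)) / (x + b).

(* Main.v *)
(* Every term is a combination of two consecutive Hermite polynomials with
   coefficients rational in [x], [b] and [n].  The three-term recurrence
   [h_{n+2} = x h_{n+1} - (n+1)/2 h_n], read upwards and downwards, reduces
   both sides to the pair [h_{n-2}, h_{n-1}], and the statement becomes an
   identity of rational functions; [n = 0] and [n = 1] are treated apart
   because there the terms with negative index vanish. *)
Require Import Defs.
From HB Require Import structures.
From mathcomp Require Import all_boot all_order all_algebra.
From mathcomp Require Import reals.
From mathcomp.real_closed Require Import complex.
From mathcomp Require Import zify ring.

Set Implicit Arguments.
Unset Strict Implicit.
Unset Printing Implicit Defensive.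

Import Order.TTheory GRing.Theory Num.Theory.
Local Open Scope ring_scope.
Local Open Scope complex_scope.

Lemma extzSB1 (F : fieldType) (f : nat -> F) (n : nat) :
  extz f (n.+1%:Z - 1) = f n.
Proof. by rewrite -addn1 PoszD addrK. Qed.

Lemma extzSSB2 (F : fieldType) (f : nat -> F) (n : nat) :
  extz f (n.+2%:Z - 2) = f n.
Proof. by rewrite -addn2 PoszD addrK. Qed.

Lemma JbopE (F : fieldType) (b : F) (f : nat -> F) (n : nat) :
  (@Jop F + scalop b)%op f n
    = f n.+1 + n%:R / 2%:R * extz f (n%:Z - 1) + b * f n.
Proof. by rewrite /addop /Jop /addop {1}/shift -PoszD addn1. Qed.

Lemma UopE (F : fieldType) (b : F) (f : nat -> F) (n : nat) :
  Uop b f n = b * f n + n%:R * extz f (n%:Z - 1).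
Proof. by []. Qed.

Lemma VopE (F : fieldType) (b : F) (f : nat -> F) (n : nat) :
  Vop b f n = 2%:R * f n.+1 + b * f n.
Proof.
by rewrite /Vop /addop /mulop /scalop /coefop /shift -PoszD addn1.
Qed.

Lemma UhatopE (F : fieldType) (b : F) (f : nat -> F) (n : nat) :
  Uhatop b f n
    = (b * f n + n%:R * extz f (n%:Z - 1)) / (b ^+ 2 - 2%:R * n%:R).
Proof. by rewrite /Uhatop /mulop /coefop UopE mulrC. Qed.

Lemma VhatopE (F : fieldType) (b : F) (f : nat -> F) (n : nat) :
  Vhatop b f n
    = (2%:R * f n.+1 + b * f n) / (b ^+ 2 - 2%:R * n%:R - 2%:R).
Proof. by rewrite /Vhatop /mulop /coefop VopE mulrC. Qed.

Section HermiteRecurrence.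
Variable F : numFieldType.

(** For [2 * j > n] the truncated [n - 2 * j] is 0 and the bare formula would not vanish; the guard
    makes these coefficients 0, so that sums of different lengths can be padded to a common
    range. *)
Definition hermite_coef (n j : nat) : F :=
  if (2 * j <= n)%N then
    (n`!)%:R / (((n - 2 * j)`!)%:R * (j`!)%:R) * (- 4%:R) ^- j
  else 0.

Lemma hermite_widen (n N : nat) : (n./2 < N)%N ->
  hermite F n = \sum_(j < N) hermite_coef n j *: 'X^(n - 2 * j).
Proof.
move=> ltnN; rewrite /hermite.
transitivity (\sum_(j < n./2.+1) hermite_coef n j *: 'X^(n - 2 * j) : {poly F}).
  apply: eq_bigr => j _; rewrite /hermite_coef ifT //.
  by have := ltn_ord j; lia.
rewrite (big_ord_widen N (fun j => hermite_coef n j *: 'X^(n - 2 * j))) //.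
rewrite big_mkcond /=; apply: eq_bigr => j _.
case: ifP => // /negbT nlt; rewrite /hermite_coef ifF ?scale0r //.
by apply/negbTE; lia.
Qed.

Lemma hermite_coef0 (n : nat) : hermite_coef n 0 = 1.
Proof.
rewrite /hermite_coef muln0 leq0n subn0 fact0 mulr1 expr0 invr1 mulr1 divff //.
by rewrite pnatr_eq0 -lt0n fact_gt0.
Qed.

(** The three-term recurrence, coefficient by coefficient. After division by the common factor
    $\frac{(n+1)!}{(n-2j)!\,(j+1)!}(-4)^{-j-1}$ it reads $n+2=(n-2j)+2(j+1)$. *)
Lemma hermite_coefS (n j : nat) :
  hermite_coef n.+2 j.+1 =
  hermite_coef n.+1 j.+1 - n.+1%:R / 2%:R * hermite_coef n j.
Proof.
have fact_neq0 m : (m`!)%:R != 0 :> F by rewrite pnatr_eq0 -lt0n fact_gt0.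
have n4 : (- 4%:R) != 0 :> F by rewrite oppr_eq0 pnatr_eq0.
have n4j : (- 4%:R) ^+ j != 0 :> F by rewrite expf_neq0.
rewrite /hermite_coef.
have [lt_nj|le_jn] := ltnP n (2 * j).
  by rewrite !ifF ?mulr0 ?subr0 //; apply/negbTE; lia.
rewrite (_ : (2 * j.+1 <= n.+2)%N); last by lia.
(* With $n=2j+k$ every truncated difference becomes explicit in $k$. *)
have [k ->] : exists k, n = (2 * j + k)%N by exists (n - 2 * j)%N; lia.
have -> : ((2 * j + k).+2 - 2 * j.+1 = k)%N by lia.
have -> : ((2 * j + k) - 2 * j = k)%N by lia.
rewrite exprS !factS !natrM.
move: ((- 4%:R) ^+ j) n4j => c c_neq0.
(* For $k=0$ the power of index $j+1$ is absent from $h_{n+1}$, so the guard gives 0 there. *)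
case: k => [|k].
  rewrite ifF; last by apply/negbTE; lia.
  rewrite fact0 addn0; field.
  by rewrite !fact_neq0 c_neq0 /= nat1r pnatr_eq0.
rewrite ifT; last by lia.
have -> : ((2 * j + k.+1).+1 - 2 * j.+1 = k)%N by lia.
rewrite !factS !natrM; field.
by rewrite !fact_neq0 c_neq0 /= !nat1r !pnatr_eq0.
Qed.

Lemma hermiteSS (n : nat) :
  hermite F n.+2 = 'X * hermite F n.+1 - (n.+1%:R / 2%:R) *: hermite F n.
Proof.
(* Term $j$ of $h_n$ pairs with term $j+1$ of the other two, so its sum is one term shorter; the
   unpaired terms $j=0$ are both $x^{n+2}$. *)
rewrite (@hermite_widen n.+2 n.+3) ?(@hermite_widen n.+1 n.+3)
  ?(@hermite_widen n n.+2); try lia.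
rewrite [LHS]big_ord_recl [X in 'X * X]big_ord_recl /= !hermite_coef0.
rewrite !muln0 !subn0 !scale1r mulrDr -exprS -addrA; congr (_ + _).
rewrite mulr_sumr scaler_sumr -sumrB; apply: eq_bigr => j _.
rewrite /bump /= add1n hermite_coefS scalerBl scalerA.
have -> : (n.+2 - 2 * j.+1 = n - 2 * j)%N by lia.
congr (_ - _); rewrite -scalerAr -exprS.
(* Beyond the range of $h_{n+1}$ truncation makes the two exponents differ, but the coefficient is
   0. *)
have [lt_nj|le_jn] := ltnP n.+1 (2 * j.+1).
  by rewrite /hermite_coef ifF ?scale0r //; apply/negbTE; lia.
by congr (_ *: 'X^_); lia.
Qed.

Lemma horner_hermite0 (x : F) : (hermite F 0).[x] = 1.
Proof.
by rewrite (@hermite_widen 0 1) // big_ord1 hermite_coef0 scale1r !hornerE.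
Qed.

Lemma horner_hermite1 (x : F) : (hermite F 1).[x] = x.
Proof.
by rewrite (@hermite_widen 1 1) // big_ord1 hermite_coef0 scale1r !hornerE.
Qed.

Lemma horner_hermiteSS (n : nat) (x : F) :
  (hermite F n.+2).[x] =
  x * (hermite F n.+1).[x] - n.+1%:R / 2%:R * (hermite F n).[x].
Proof. by rewrite hermiteSS !hornerE. Qed.

(** The recurrence solved for its lowest term. It removes the index $n-1$ from $\hat h_n$ uniformly
    in $n$; at $n=0$ it says $h_1=x h_0$. *)
Lemma hermite_down (n : nat) (x : F) :
  n%:R * extz (fun m => (hermite F m).[x]) (n%:Z - 1) =
  2%:R * (x * (hermite F n).[x] - (hermite F n.+1).[x]).
Proof.
case: n => [|n].
  by rewrite mul0r horner_hermite0 horner_hermite1 mulr1 subrr mulr0.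
by rewrite extzSB1 horner_hermiteSS; field.
Qed.

Lemma hhatE (b x : F) (n : nat) :
  hhat b n x = (b ^+ 2 - 2%:R * n%:R) * (hermite F n).[x]
    - (b * (hermite F n).[x]
       + 2%:R * (x * (hermite F n).[x] - (hermite F n.+1).[x])) / (x + b).
Proof. by rewrite /hhat hermite_down. Qed.

End HermiteRecurrence.

Section HhatRecurrence.
Variables (F : numFieldType) (b x : F).
Hypothesis hb : forall k : nat, b ^+ 2 != (2 * k)%:R.
Hypothesis hx : x + b != 0.

Let h (m : nat) : F := hhat b m x.
Let v (m : nat) : F :=
  (2%:R * h m.+1 + b * h m) / (b ^+ 2 - 2%:R * m%:R - 2%:R).
Let u (m : nat) : F :=
  (b * h m + m%:R * extz h (m%:Z - 1)) / (b ^+ 2 - 2%:R * m%:R).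

Lemma hhat_recurrence (n : nat) :
  (x + b) ^+ 2 * h n
    = h n.+2 + 2%:R * b * h n.+1 + (b ^+ 2 + n%:R + 2%:R^-1) * h n
      + b * n%:R * extz h (n%:Z - 1)
      + 4%:R^-1 * n%:R * (n%:R - 1) * extz h (n%:Z - 2)
      + 2%:R * v n.+1 + b * v n - b * u n - n%:R * extz u (n%:Z - 1).
Proof.
(* All denominators except $x+b$ have the form $b^2-2k$; [c] stands for whatever shape [field] gives
   them. *)
have nz k c : c = b ^+ 2 - 2%:R * k%:R -> c != 0.
  by move=> ->; rewrite -natrM subr_eq0.
have b_neq0 : b != 0 by have := hb 0; rewrite muln0 sqrf_eq0.
case: n => [|[|n]].
- rewrite /v /u /h /= !hhatE !horner_hermiteSS.
  rewrite horner_hermite0 horner_hermite1.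
  field; rewrite b_neq0 hx /=.
  by apply/andP; split; [apply: (nz 1%N)|apply: (nz 2%N)]; ring.
- rewrite !extzSB1 /v /u !extzSB1 /h /= !hhatE !horner_hermiteSS.
  rewrite horner_hermite0 horner_hermite1.
  field; rewrite b_neq0 hx /=.
  by apply/and3P; split;
    [apply: (nz 1%N)|apply: (nz 2%N)|apply: (nz 3%N)]; ring.
rewrite extzSSB2 !extzSB1 /v /u !extzSB1 /h !hhatE !horner_hermiteSS.
field; rewrite hx /=.
(* At index $n+2$ these come, in order, from $\hat u_{n+1}$, $\hat u_{n+2}$, $\hat v_{n+2}$ and
   $\hat v_{n+3}$. *)
by apply/and4P; split;
  [apply: (nz n.+1)|apply: (nz n.+2)|apply: (nz n.+3)|apply: (nz n.+4)]; ring.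
Qed.

(** Purely formal in the sequence [h]: in $(\mathsf J+b)^2$ the term $n+\tfrac12$ is
    $\tfrac{n+1}2+\tfrac n2$, from the two orders of composing $\mathsf S_n$ with $\tfrac n2\mathsf
    S_n^{-1}$. *)
Lemma hhat_op_expansion (n : nat) :
  ((@Jop F + scalop b) * (@Jop F + scalop b))%op h n
    + (Vop b * Vhatop b - Uop b * Uhatop b)%op h n
  = h n.+2 + 2%:R * b * h n.+1 + (b ^+ 2 + n%:R + 2%:R^-1) * h n
      + b * n%:R * extz h (n%:Z - 1)
      + 4%:R^-1 * n%:R * (n%:R - 1) * extz h (n%:Z - 2)
      + 2%:R * v n.+1 + b * v n - b * u n - n%:R * extz u (n%:Z - 1).
Proof.
rewrite /subop /mulop !JbopE VopE UopE !VhatopE UhatopE.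
rewrite -/(v n) -/(v n.+1) -/(u n).
(* The two sequences are compared pointwise, by the sign of the index. *)
have -> : extz (Uhatop b h) (n%:Z - 1) = extz u (n%:Z - 1).
  by case: (n%:Z - 1) => //= m; rewrite UhatopE.
case: n => [|[|n]]; rewrite ?extzSB1 ?extzSSB2 ?JbopE ?extzSB1 /=;
  by field.
Qed.

End HhatRecurrence.

Theorem proposition2p5 (R : realType) (b : R[i])
    (hb : forall k : nat, b ^+ 2 != (2 * k)%:R)
    (x : R[i]) (hx : x + b != 0) (n : nat) :
  let h : nat -> R[i] := fun m => hhat b m x in
  let v : nat -> R[i] := fun m =>
    (2%:R * h m.+1 + b * h m) / (b ^+ 2 - 2%:R * m%:R - 2%:R) in
  let u : nat -> R[i] := fun m =>
    (b * h m + m%:R * extz h (m%:Z - 1)) / (b ^+ 2 - 2%:R * m%:R) in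
  let Jb : seqop R[i] := (@Jop _ + scalop b)%op in
  [/\ (x + b) ^+ 2 * h n
        = (Jb * Jb)%op h n
          + (Vop b * Vhatop b - Uop b * Uhatop b)%op h n,
      (x + b) ^+ 2 * h n
        = h n.+2 + 2%:R * b * h n.+1 + (b ^+ 2 + n%:R + 2%:R^-1) * h n
          + b * n%:R * extz h (n%:Z - 1)
          + 4%:R^-1 * n%:R * (n%:R - 1) * extz h (n%:Z - 2)
          + 2%:R * v n.+1 + b * v n - b * u n - n%:R * extz u (n%:Z - 1),
      v n = Vhatop b h n
    & u n = Uhatop b h n].
Proof.
move=> h v u Jb; split.
- by rewrite hhat_op_expansion; exact: hhat_recurrence.
- exact: hhat_recurrence.
- by rewrite VhatopE.
- by rewrite UhatopE.
Qed.
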